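(* Let $n\ge 1$, let $\alpha\ge 1$, and let $(Q_1,\ldots,Q_n)$ be an $\alpha$-conditioned doubly stochastic $n$-tuple of positive definite real symmetric $n\times n$ matrices. Then $$D(Q_1,\ldots,Q_n)\ \le\ n^{\alpha^4}e^{-(n-1)}.$$
   Context: For real symmetric $n\times n$ matrices $Q_1,\ldots,Q_n$, the mixed discriminant is $D(Q_1,\ldots,Q_n)=\frac{\partial^n}{\partial t_1\cdots\partial t_n}\det(t_1Q_1+\cdots+t_nQ_n)$, i.e. the coefficient of $t_1\cdots t_n$ in the homogeneous polynomial $\det(t_1Q_1+\cdots+t_nQ_n)$. An $n$-tuple $(Q_1,\ldots,Q_n)$ of positive semidefinite $n\times n$ matrices is doubly stochastic if $Q_1+\cdots+Q_n=I$ (the identity matrix) and $\operatorname{tr}Q_1=\cdots=\operatorname{tr}Q_n=1$. For $\alpha\ge1$, an $n$-tuple of positive definite matrices is $\alpha$-conditioned if $\lambda_{\max}(Q_i)\le\alpha\,\lambda_{\min}(Q_j)$ for all $1\le i,j\le n$ (including $i=j$), where $\lambda_{\max},\lambda_{\min}$ denote the largest and smallest eigenvalues. *)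

(* Defs.v *)
From Stdlib Require Import Reals Lra ClassicalEpsilon FunctionalExtensionality.
From HB Require Import structures.
From mathcomp Require Import all_boot all_order all_algebra all_fingroup.
Set Implicit Arguments. Unset Strict Implicit. Unset Printing Implicit Defensive.
Import GRing.Theory.

Local Open Scope R_scope.

Definition Req_bool (x y : R) : bool := if Req_EM_T x y then true else false.
Lemma Req_boolP : Equality.axiom Req_bool.
Proof. by move=> x y; rewrite /Req_bool; case: Req_EM_T => h; constructor. Qed.
HB.instance Definition _ := hasDecEq.Build R Req_boolP.

Definition R_find (P : pred R) (_ : nat) : option R :=
  match excluded_middle_informative (exists x, P x) with
  | left h => Some (proj1_sig (constructive_indefinite_description _ h))
  | right _ => None
  end.
Lemma R_find_correct P n x : R_find P n = Some x -> P x.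
Proof.
rewrite /R_find; case: excluded_middle_informative => // h [<-].
exact: proj2_sig (constructive_indefinite_description _ h).
Qed.
Lemma R_find_complete (P : pred R) : (exists x, P x) -> exists n, R_find P n.
Proof. by move=> h; exists 0%N; rewrite /R_find; case: excluded_middle_informative. Qed.
Lemma R_find_ext (P Q : pred R) : P =1 Q -> R_find P =1 R_find Q.
Proof. by move=> /functional_extensionality ->. Qed.
HB.instance Definition _ :=
  hasChoice.Build R R_find_correct R_find_complete R_find_ext.

Lemma R_addA : associative Rplus. Proof. by move=> *; ring. Qed.
Lemma R_addC : commutative Rplus. Proof. by move=> *; ring. Qed.
Lemma R_add0 : left_id 0 Rplus. Proof. by move=> *; ring. Qed.
Lemma R_addN : left_inverse 0 Ropp Rplus. Proof. by move=> *; ring. Qed.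
HB.instance Definition _ := GRing.isZmodule.Build R R_addA R_addC R_add0 R_addN.

Lemma R_mulA : associative Rmult. Proof. by move=> *; ring. Qed.
Lemma R_mulC : commutative Rmult. Proof. by move=> *; ring. Qed.
Lemma R_mul1 : left_id 1 Rmult. Proof. by move=> *; ring. Qed.
Lemma R_mulDl : left_distributive Rmult Rplus. Proof. by move=> *; ring. Qed.
Lemma R_one_neq0 : (1 : R) != 0.
Proof. by apply/eqP; exact: R1_neq_R0. Qed.
HB.instance Definition _ :=
  GRing.Zmodule_isComNzRing.Build R R_mulA R_mulC R_mul1 R_mulDl R_one_neq0.

Definition R_inv (x : R) : R := if x == 0 then 0 else / x.
Lemma R_mulVf (x : R) : x != 0 -> (R_inv x * x)%R = 1%R.
Proof.
move=> /negPf hx; rewrite /R_inv hx /=.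
by apply: Rinv_l => h; move: hx; rewrite h eqxx.
Qed.
Lemma R_inv0 : R_inv 0 = 0. Proof. by rewrite /R_inv eqxx. Qed.
HB.instance Definition _ := GRing.ComNzRing_isField.Build R R_mulVf R_inv0.

Local Open Scope ring_scope.

Definition symmetric_mx (n : nat) (A : 'M[R]_n) : Prop := A^T = A.

Definition psd_mx (n : nat) (A : 'M[R]_n) : Prop :=
  symmetric_mx A /\ forall x : 'cV[R]_n, Rle 0 ((x^T *m A *m x) ord0 ord0).
Definition pd_mx (n : nat) (A : 'M[R]_n) : Prop :=
  symmetric_mx A /\
  forall x : 'cV[R]_n, x <> 0 -> Rlt 0 ((x^T *m A *m x) ord0 ord0).

Definition doubly_stochastic (n : nat) (Q : 'I_n -> 'M[R]_n) : Prop :=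
  (forall i, psd_mx (Q i)) /\
  \sum_(i < n) Q i = 1%:M /\
  (forall i, \tr (Q i) = 1).

(* alpha-conditioned n-tuple of positive definite matrices:
   lambda_max(Q_i) <= alpha * lambda_min(Q_j) for all i, j, written as
   "every eigenvalue a of Q_i and every eigenvalue b of Q_j satisfy
   a <= alpha * b" (max over eigenvalues of Q_i vs. min over those of Q_j). *)
Definition alpha_conditioned (n : nat) (alpha : R) (Q : 'I_n -> 'M[R]_n) : Prop :=
  (forall i, pd_mx (Q i)) /\
  forall (i j : 'I_n) (a b : R),
    eigenvalue (Q i) a -> eigenvalue (Q j) b -> Rle a (alpha * b).

(* Mixed discriminant: the coefficient of t_1 ... t_n in
   det(t_1 Q_1 + ... + t_n Q_n).  Expanding the Leibniz formula
   det(sum_i t_i Q_i) = sum_s sgn s prod_j (sum_i t_i (Q_i) (s j) j)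
   multilinearly, the monomial t_1...t_n arises exactly from the choices
   j |-> tau j with tau a permutation, so this coefficient is
   sum_tau det(matrix whose j-th column is the j-th column of Q_(tau j)). *)
Definition mixed_discriminant (n : nat) (Q : 'I_n -> 'M[R]_n) : R :=
  \sum_(tau : 'S_n) \det (\matrix_(i < n, j < n) Q (tau j) i j).

(* Main.v *)
(** The bound D(Q_1, ..., Q_n) <= n^alpha e^{-(n-1)} det(Q_1 + ... + Q_n) holds
    whenever q_i <= alpha q_j for all i, j as quadratic forms; unlike double
    stochasticity, this hypothesis is invariant under congruence and under
    restriction to subspaces, so one can induct on n.  A congruence makes one of
    the matrices the identity; then D is the sum over k of the mixed
    discriminants of the k-th principal minors of the others, and with P the sum
    of the others the induction hypothesis bounds it by a constant times
    tr(adj P) = det P tr(P^-1).  Put N = P + I and t = tr(N^-1).  As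
    P >= ((n-1)/alpha) I, tr(P^-1) <= (1 + alpha/(n-1)) t, while
    det P <= det N e^{-t}; since t e^{-t} <= e^{-1} and, by Bernoulli,
    1 + alpha/(n-1) <= (n/(n-1))^alpha, each step costs a factor
    (n/(n-1))^alpha e^{-1} and these telescope. *)

Require Import Defs.
From Stdlib Require Import Reals.
From HB Require Import structures.
From mathcomp Require Import all_boot all_order all_algebra all_fingroup.
From mathcomp Require Import ring lra.
Set Implicit Arguments. Unset Strict Implicit. Unset Printing Implicit Defensive.
Import Order.TTheory GRing.Theory Num.Theory.
Local Open Scope ring_scope.

(** * The reals as an ordered field *)

Definition R_leb (x y : R) : bool := if Rle_dec x y then true else false.
Definition R_ltb (x y : R) : bool := if Rlt_dec x y then true else false.

Lemma R_leP x y : reflect (Rle x y) (R_leb x y).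
Proof. by rewrite /R_leb; case: Rle_dec => h; constructor. Qed.

Lemma R_ltP x y : reflect (Rlt x y) (R_ltb x y).
Proof. by rewrite /R_ltb; case: Rlt_dec => h; constructor. Qed.

Lemma R_le0_add x y : R_leb 0 x -> R_leb 0 y -> R_leb 0 (x + y).
Proof. by move=> /R_leP hx /R_leP hy; apply/R_leP; apply: Rplus_le_le_0_compat. Qed.

Lemma R_le0_mul x y : R_leb 0 x -> R_leb 0 y -> R_leb 0 (x * y).
Proof. by move=> /R_leP hx /R_leP hy; apply/R_leP; apply: Rmult_le_pos. Qed.

Lemma R_le0_anti x : R_leb 0 x -> R_leb x 0 -> x = 0.
Proof. by move=> /R_leP hx /R_leP hy; apply: Rle_antisym. Qed.

Lemma R_sub_ge0 x y : R_leb 0 (y - x) = R_leb x y.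
Proof.
apply/R_leP/R_leP => h; last exact/Rge_le/Rge_minus/Rle_ge.
by apply: Rnot_lt_le => /Rlt_minus; apply: Rle_not_lt.
Qed.

Lemma R_le0_total x : R_leb 0 x || R_leb x 0.
Proof.
by apply/orP; case: (Rle_or_lt 0 x) => h; [left|right]; apply/R_leP => //; apply: Rlt_le.
Qed.

Lemma R_ge0_norm x : R_leb 0 x -> Rabs x = x.
Proof. by move=> /R_leP /Rle_ge; apply: Rabs_right. Qed.

Lemma R_lt_def x y : R_ltb x y = (y != x) && R_leb x y.
Proof.
apply/R_ltP/andP => [h|[/eqP h /R_leP [//|e]]]; last by case: h.
split; last exact/R_leP/Rlt_le.
by apply/eqP => e; move: h; rewrite e; apply: Rlt_irrefl.
Qed.

HB.instance Definition _ := Num.IntegralDomain_isLeReal.Build R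
  R_le0_add R_le0_mul R_le0_anti R_sub_ge0 R_le0_total Rabs_Ropp R_ge0_norm R_lt_def.

Lemma RleP (x y : R) : reflect (Rle x y) (x <= y).
Proof. exact: R_leP. Qed.

Lemma RltP (x y : R) : reflect (Rlt x y) (x < y).
Proof. exact: R_ltP. Qed.

(* Stdlib parses arguments of type R in R_scope, i.e. with Rplus, Rminus, ...
   instead of the ring operations. *)
Bind Scope ring_scope with R.
Arguments exp _%_ring_scope.
Arguments ln _%_ring_scope.

(** * Inequalities for the exponential and the logarithm *)

Lemma exp_ge1D (x : R) : 1 + x <= exp x.
Proof. exact/RleP/exp_ineq1_le. Qed.

Lemma exp_gt0 (x : R) : 0 < exp x.
Proof. exact/RltP/exp_pos. Qed.

Lemma expD (x y : R) : exp (x + y) = exp x * exp y.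
Proof. exact: exp_plus. Qed.

Lemma bernoulli (a x : R) : 1 <= a -> 0 <= x -> 1 + a * x <= exp (a * ln (1 + x)).
Proof.
move=> a1 x0; have ax : 0 <= a * x by apply: mulr_ge0 => //; lra.
have eln (y : R) : 0 < y -> exp (ln y) = y by move=> /RltP; apply: exp_ln.
(* Average the tangent bounds for exp at L, evaluated at a L and at 0. *)
set L := ln (1 + a * x) / a.
have aL : a * L = ln (1 + a * x) by rewrite /L; field; lra.
have h1 := exp_ge1D ((a - 1) * L).
have h2 := exp_ge1D (- L).
have e1 : exp L * exp ((a - 1) * L) = 1 + a * x.
  rewrite -expD; have -> : L + (a - 1) * L = a * L by ring.
  by rewrite aL eln; lra.
have e2 : exp L * exp (- L) = 1 by rewrite -expD subrr exp_0.
have eL : exp L <= 1 + x.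
  have h3 : exp L * (1 + (a - 1) * L) <= 1 + a * x.
    by rewrite -e1 ler_pM2l ?exp_gt0.
  have h4 : exp L * (1 - L) <= 1 by rewrite -[X in _ <= X]e2 ler_pM2l ?exp_gt0.
  (* Adding [a - 1] times [h4] to [h3] cancels [L] and leaves [a * exp L <= a * (1 + x)]. *)
  rewrite -(@ler_pM2l _ a); last lra.
  nra.
have : L <= ln (1 + x).
  rewrite leNgt; apply/negP => /RltP /exp_increasing /RltP.
  by rewrite eln; lra.
rewrite -(@ler_pM2l _ a); last lra.
rewrite aL le_eqVlt => /orP[/eqP <-|/RltP /exp_increasing /RltP /ltW].
  by rewrite eln; lra.
by rewrite eln; lra.
Qed.

Lemma ln_natr_succ n :
  ln n.+2%:R = ln n.+1%:R + ln (1 + n.+1%:R^-1).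
Proof.
have n0 : 0 < n.+1%:R :> R by rewrite ltr0n.
have -> : n.+2%:R = n.+1%:R * (1 + n.+1%:R^-1) :> R.
  by rewrite mulrDr mulr1 divff ?gt_eqF // natr1.
apply: ln_mult; apply/RltP => //.
by rewrite addr_gt0 ?invr_gt0.
Qed.

(** * Positive definite matrices *)

Definition qform n (A : 'M[R]_n) (x : 'cV[R]_n) : R := (x^T *m A *m x) ord0 ord0.

Lemma qformD n (A B : 'M[R]_n) x : qform (A + B) x = qform A x + qform B x.
Proof. by rewrite /qform mulmxDr mulmxDl mxE. Qed.

Lemma qformN n (A : 'M[R]_n) x : qform (- A) x = - qform A x.
Proof. by rewrite /qform mulmxN mulNmx mxE. Qed.

Lemma qformZ n c (A : 'M[R]_n) x : qform (c *: A) x = c * qform A x.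
Proof. by rewrite /qform -scalemxAr -scalemxAl mxE. Qed.

Lemma qform_sum n (I : finType) (F : I -> 'M[R]_n) x :
  qform (\sum_i F i) x = \sum_i qform (F i) x.
Proof. by rewrite /qform mulmx_sumr mulmx_suml summxE. Qed.

Lemma qform_congr m n (W : 'M[R]_(m, n)) (A : 'M[R]_n) x :
  qform (W *m A *m W^T) x = qform A (W^T *m x).
Proof. by rewrite /qform trmx_mul trmxK !mulmxA. Qed.

Lemma qform1 n (x : 'cV[R]_n) : qform 1%:M x = \sum_i x i ord0 ^+ 2.
Proof. by rewrite /qform mulmx1 mxE; apply: eq_bigr => i _; rewrite mxE expr2. Qed.

Lemma qform1_ge0 n (x : 'cV[R]_n) : 0 <= qform 1%:M x.
Proof. by rewrite qform1; apply: sumr_ge0 => i _; apply: sqr_ge0. Qed.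

Lemma qform1_gt0 n (x : 'cV[R]_n) : x != 0 -> 0 < qform 1%:M x.
Proof.
move=> x0; rewrite lt_def qform1_ge0 andbT; apply: contra x0.
rewrite qform1 psumr_eq0; last by move=> i _; apply: sqr_ge0.
move/allP => h; apply/eqP/colP => i.
by have := h i (mem_index_enum i); rewrite sqrf_eq0 mxE => /eqP.
Qed.

Lemma pd_mx_tr n (A : 'M[R]_n) : pd_mx A -> A^T = A.
Proof. by case. Qed.

Lemma pd_mxP n (A : 'M[R]_n) x : pd_mx A -> x != 0 -> 0 < qform A x.
Proof. by move=> [_ h] /eqP /h /RltP. Qed.

Lemma pd_mxI n (A : 'M[R]_n) :
  A^T = A -> (forall x, x != 0 -> 0 < qform A x) -> pd_mx A.
Proof. by move=> sA h; split=> // x /eqP /h /RltP. Qed.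

Lemma pd_mx_ge0 n (A : 'M[R]_n) x : pd_mx A -> 0 <= qform A x.
Proof.
move=> pA; have [->|/(pd_mxP pA) /ltW //] := eqVneq x 0.
by rewrite /qform mulmx0 mxE.
Qed.

(** [V] witnesses that [W^T] is injective. Rectangular [W] is allowed so that Schur complements and
    principal minors are covered as well as invertible congruences. *)
Lemma pd_congr m n (W : 'M[R]_(m, n)) (V : 'M[R]_(m, n)) (A : 'M[R]_n) :
  V *m W^T = 1%:M -> pd_mx A -> pd_mx (W *m A *m W^T).
Proof.
move=> VW pA; apply: pd_mxI => [|x x0].
  by rewrite !trmx_mul trmxK (pd_mx_tr pA) mulmxA.
rewrite qform_congr; apply: pd_mxP => //; apply: contra x0 => /eqP h.
by rewrite -[x]mul1mx -VW -mulmxA h mulmx0.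
Qed.

Lemma pd_congr_unit n (W A : 'M[R]_n) :
  W \in unitmx -> pd_mx A -> pd_mx (W *m A *m W^T).
Proof.
by move=> uW; apply: (@pd_congr _ _ W (invmx W^T)); rewrite mulVmx // unitmx_tr.
Qed.

Lemma pd_sum n (I : finType) (i0 : I) (F : I -> 'M[R]_n) :
  (forall i, pd_mx (F i)) -> pd_mx (\sum_i F i).
Proof.
move=> pF; apply: pd_mxI => [|x x0].
  by rewrite raddf_sum; apply: eq_bigr => i _; apply: pd_mx_tr.
rewrite qform_sum (bigD1 i0) //= ltr_pwDl //; first exact: pd_mxP.
by apply: sumr_ge0 => i _; apply: pd_mx_ge0.
Qed.

Lemma pd1 n : @pd_mx n 1%:M.
Proof. by apply: pd_mxI; [rewrite trmx1 | move=> x; apply: qform1_gt0]. Qed.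

Lemma pdD n (A B : 'M[R]_n) : pd_mx A -> pd_mx B -> pd_mx (A + B).
Proof.
move=> pA pB; apply: pd_mxI => [|x x0]; first by rewrite linearD /= !pd_mx_tr.
by rewrite qformD addr_gt0 //; apply: pd_mxP.
Qed.

Lemma pd_diag_gt0 n (A : 'M[R]_n) i : pd_mx A -> 0 < A i i.
Proof.
move=> pA; have -> : A i i = qform A (delta_mx i ord0).
  by rewrite /qform trmx_delta -mulmxA -colE -rowE !mxE.
apply: pd_mxP => //; apply/eqP => /matrixP /(_ i ord0); rewrite !mxE !eqxx.
by move/eqP; rewrite oner_eq0.
Qed.

Lemma mxtrace_qform n (A : 'M[R]_n) : \tr A = \sum_i qform A (delta_mx i ord0).
Proof.
by apply: eq_bigr => i _; rewrite /qform trmx_delta -mulmxA -colE -rowE !mxE.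
Qed.

Lemma schur_complement n (A : 'M[R]_(1 + n)) :
  pd_mx A ->
  exists a (v : 'cV[R]_n) S,
    [/\ 0 < a, pd_mx S & A = block_mx a%:M v^T v (S + a^-1 *: (v *m v^T))].
Proof.
move=> pA; pose a := A ord0 ord0; pose v := dlsubmx A.
have a0 : 0 < a by apply: pd_diag_gt0.
have eA : A = block_mx a%:M v^T v (drsubmx A).
  rewrite -[LHS]submxK; congr block_mx.
    by rewrite [LHS]mx11_scalar !mxE; congr (_%:M); congr (A _ _); apply: val_inj.
  by rewrite /v trmx_dlsub (pd_mx_tr pA).
(* [E] performs one step of elimination: [E *m A] has first column 0, so [E *m A *m E^T] is the
   Schur complement of [a]. *)
pose E : 'M[R]_(n, 1 + n) := row_mx (- a^-1 *: v) 1%:M.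
exists a, v, (drsubmx A - a^-1 *: (v *m v^T)); split=> //; last by rewrite subrK.
have <- : E *m A *m E^T = drsubmx A - a^-1 *: (v *m v^T).
  rewrite {1}eA /E tr_row_mx mul_row_block mul_row_col trmx1 mulmx1 !mul1mx.
  rewrite mul_mx_scalar scalerA mulrN divff ?gt_eqF // scaleN1r addNr mul0mx add0r.
  by rewrite -scalemxAl scaleNr addrC.
apply: (@pd_congr _ _ E (row_mx 0 1%:M)) => //.
by rewrite tr_row_mx mul_row_col mul0mx add0r trmx1 mulmx1.
Qed.

(** Induction on the size: the factor of the Schur complement is bordered by [sqrt a] and
    [v / sqrt a]. Congruence by [invmx W] then turns [A] into the identity. *)
Lemma cholesky n (A : 'M[R]_n) :
  pd_mx A -> exists W, [/\ is_trig_mx W, W \in unitmx & A = W *m W^T].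
Proof.
elim: n A => [|n IH] A pA.
  by exists 1%:M; split; rewrite ?unitmx1 //; rewrite [A]flatmx0 [RHS]flatmx0.
have [a [v [S [a0 pS ->]]]] := schur_complement (n := n) pA.
have [W [tW uW ->]] := IH S pS.
have s0 : sqrt a != 0.
  by apply/eqP => e; have := sqrt_lt_R0 a (RltP _ _ a0); rewrite e => /RltP; rewrite ltxx.
have ss : sqrt a * sqrt a = a by apply: sqrt_sqrt; apply/RleP/ltW.
exists (block_mx (sqrt a)%:M 0 ((sqrt a)^-1 *: v) W); split.
- by rewrite (@is_trig_block_mx _ 1 n 1 n) // eqxx scalar_mx_is_trig.
- rewrite unitmxE (@det_lblock _ 1 n) det_scalar1 unitrM -unitmxE uW andbT.
  by rewrite unitfE.
rewrite (@tr_block_mx _ 1 n 1 n) (@mulmx_block _ 1 n 1 n 1 n) !trmx0.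
rewrite tr_scalar_mx !mul0mx !mulmx0 !addr0.
rewrite -scalar_mxM ss linearZ /= mul_scalar_mx mul_mx_scalar !scalerA.
rewrite divff // !scale1r -scalemxAl -scalemxAr scalerA -invfM ss.
by rewrite [_ + W *m _]addrC.
Qed.

Lemma pd_unit n (A : 'M[R]_n) : pd_mx A -> A \in unitmx.
Proof.
by move=> /cholesky[W [_ uW ->]]; rewrite unitmx_mul unitmx_tr uW.
Qed.

Lemma pd_inv n (A : 'M[R]_n) : pd_mx A -> pd_mx (invmx A).
Proof.
move=> pA; have uA := pd_unit pA.
have -> : invmx A = invmx A *m A *m (invmx A)^T.
  by rewrite mulVmx // mul1mx trmx_inv pd_mx_tr.
by apply: pd_congr_unit => //; rewrite unitmx_inv.
Qed.

Lemma pd_det_gt0 n (A : 'M[R]_n) : pd_mx A -> 0 < \det A.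
Proof.
move=> /cholesky[W [_ uW ->]]; rewrite det_mulmx det_tr -expr2.
by rewrite exprn_even_gt0 //= -unitfE -unitmxE.
Qed.

(** For eigenvalues this is the product of the bounds l <= e^(l-1). Schur complements replace
    diagonalization: the determinant is exactly [a * \det S], while the trace exceeds [a + \tr S] by
    a nonnegative term. *)
Lemma pd_det_le_exp_tr n (A : 'M[R]_n) : pd_mx A -> \det A <= exp (\tr A - n%:R).
Proof.
elim: n A => [|n IH] A pA.
  by rewrite det_mx00 /mxtrace big_ord0 mulr0n subr0 exp_0.
have [a [v [S [a0 pS ->]]]] := schur_complement (n := n) pA.
have -> : \det (block_mx a%:M v^T v (S + a^-1 *: (v *m v^T))) = a * \det S.
  have -> : block_mx a%:M v^T v (S + a^-1 *: (v *m v^T)) =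
     block_mx 1%:M 0 (a^-1 *: v) 1%:M *m block_mx a%:M v^T 0 S.
    rewrite mulmx_block !mul1mx !mul0mx !addr0 mul_mx_scalar scalerA.
    by rewrite divff ?gt_eqF // scale1r -scalemxAl addrC.
  by rewrite det_mulmx det_lblock det_ublock !det1 !mul1r det_scalar1.
rewrite (@mxtrace_block _ 1 n) mxtrace_scalar mulr1n mxtraceD mxtraceZ.
have tv : 0 <= a^-1 * \tr (v *m v^T).
  rewrite mulr_ge0 ?invr_ge0 ?(ltW a0) // mxtrace_mulC.
  by have := qform1_ge0 v; rewrite /qform mulmx1 /mxtrace big_ord1.
set t := a^-1 * _ in tv *.
have -> : a + (\tr S + t) - n.+1%:R = (a - 1) + (\tr S - n%:R) + t.
  by rewrite -natr1; ring.
have h1 : a <= exp (a - 1) by have := exp_ge1D (a - 1); lra.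
have h2 := IH S pS.
have h3 : 1 <= exp t by have := exp_ge1D t; lra.
rewrite (expD _ t) (expD (a - 1)).
apply: (@le_trans _ _ (exp (a - 1) * exp (\tr S - n%:R))).
  by apply: ler_pM => //; apply/ltW => //; apply: pd_det_gt0.
by rewrite ler_peMr // mulr_ge0 // ltW // exp_gt0.
Qed.

(** The tangent inequality for the concave function log det at [B]. A congruence taking [B] to the
    identity reduces it to [pd_det_le_exp_tr]. *)
Lemma pd_det_le n (A B : 'M[R]_n) : pd_mx A -> pd_mx B ->
  \det A <= \det B * exp (\tr (invmx B *m A) - n%:R).
Proof.
move=> pA pB; have [W [_ uW eB]] := cholesky pB.
pose C := invmx W *m A *m (invmx W)^T.
have pC : pd_mx C by apply: pd_congr_unit => //; rewrite unitmx_inv.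
have uWt : W^T \in unitmx by rewrite unitmx_tr.
have -> : \tr (invmx B *m A) = \tr C.
  rewrite /C [RHS]mxtrace_mulC mulmxA trmx_inv; congr (\tr (_ *m _)).
  have e : (invmx W^T *m invmx W) *m B = 1%:M.
    by rewrite eB mulmxA -(mulmxA _ (invmx W)) mulVmx // mulmx1 mulVmx.
  by rewrite -[LHS]mul1mx -e mulmxK ?pd_unit.
have -> : \det A = \det B * \det C.
  rewrite eB /C !det_mulmx !det_tr det_inv; field.
  by rewrite -unitfE -unitmxE.
by rewrite ler_pM2l ?pd_det_gt0 // pd_det_le_exp_tr.
Qed.

(* Expand A >= 0 at the vector A^-1 x - B^-1 x. *)
Lemma pd_inv_antitone n (A B : 'M[R]_n) : pd_mx A -> pd_mx B ->
  (forall x, qform A x <= qform B x) ->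
  forall x, qform (invmx B) x <= qform (invmx A) x.
Proof.
move=> pA pB AB x; set y := invmx A *m x; set z := invmx B *m x.
have uA := pd_unit pA; have uB := pd_unit pB.
have Ay : A *m y = x by rewrite mulKVmx.
have Bz : B *m z = x by rewrite mulKVmx.
have dotC (u v : 'cV[R]_n) : (u^T *m v) ord0 ord0 = (v^T *m u) ord0 ord0.
  by rewrite -[v in LHS]trmxK -trmx_mul mxE.
have h : qform A (y - z) =
    (x^T *m y) ord0 ord0 - 2 * (x^T *m z) ord0 ord0 + qform A z.
  have zAy : (z^T *m A *m y) ord0 ord0 = (x^T *m z) ord0 ord0.
    by rewrite -mulmxA Ay dotC.
  have yAz : (y^T *m A *m z) ord0 ord0 = (x^T *m z) ord0 ord0.
    by rewrite -{1}(pd_mx_tr pA) -trmx_mul Ay.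
  have yAy : (y^T *m A *m y) ord0 ord0 = (x^T *m y) ord0 ord0.
    by rewrite -mulmxA Ay dotC.
  have e : (y - z)^T *m A *m (y - z) =
     y^T *m A *m y - z^T *m A *m y - (y^T *m A *m z - z^T *m A *m z).
    by rewrite [(y - z)^T]linearB /= mulmxBl mulmxBr !mulmxBl.
  have entryB (M N : 'M[R]_1) : (M - N) ord0 ord0 = M ord0 ord0 - N ord0 ord0.
    by rewrite !mxE.
  rewrite /qform e !entryB zAy yAz yAy; ring.
have := pd_mx_ge0 (y - z) pA; rewrite h.
have := AB z; rewrite {2}/qform -mulmxA Bz dotC /qform -!mulmxA -/y -/z.
lra.
Qed.

Lemma det_mxtrace_inv_le n (P : 'M[R]_n) (k : R) : pd_mx P -> 0 < k ->
  (forall x, k * qform 1%:M x <= qform P x) ->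
  \det P * \tr (invmx P) <= (1 + k^-1) * exp (- 1) * \det (P + 1%:M).
Proof.
move=> pP k0 kP; set N := P + 1%:M; set r := 1 + k^-1; set t := \tr (invmx N).
have pN : pd_mx N by apply: pdD => //; apply: pd1.
have uN := pd_unit pN.
have ki : 0 < k^-1 by rewrite invr_gt0.
have r0 : 0 < r by rewrite /r; lra.
have ri0 : 0 < r^-1 by rewrite invr_gt0.
have prN : pd_mx (r^-1 *: N).
  apply: pd_mxI => [|x x0]; first by rewrite linearZ /= pd_mx_tr.
  by rewrite qformZ mulr_gt0 // pd_mxP.
(* From P >= k I one gets P + I <= (1 + 1/k) P; inverting this compares the two traces. *)
have le_rN x : qform (r^-1 *: N) x <= qform P x.
  rewrite qformZ mulrC ler_pdivrMr // qformD /r mulrDr mulr1 lerD2l.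
  by rewrite ler_pdivlMr // mulrC.
have t0 : 0 <= t.
  by apply: sumr_ge0 => i _; apply/ltW/pd_diag_gt0/pd_inv.
have tr_le : \tr (invmx P) <= r * t.
  rewrite /t !mxtrace_qform mulr_sumr; apply: ler_sum => i _.
  apply: le_trans (pd_inv_antitone prN pP le_rN _) _.
  by rewrite invmxZ ?pd_unit // qformZ invrK.
have det_le : \det P <= \det N * exp (- t).
  apply: le_trans (pd_det_le pP pN) _.
  have -> : invmx N *m P = 1%:M - invmx N.
    by rewrite -[X in _ *m X](addrK 1%:M) mulmxBr mulVmx // mulmx1.
  by rewrite linearB /= mxtrace1 addrAC subrr add0r.
have t_le : t * exp (- t) <= exp (- 1).
  have := exp_ge1D (t - 1); rewrite addrC subrK => h.
  have -> : exp (- 1) = exp (t - 1) * exp (- t).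
    by rewrite -expD; congr exp; ring.
  by rewrite ler_pM2r ?exp_gt0.
have dP := pd_det_gt0 pP; have dN := pd_det_gt0 pN.
apply: le_trans (_ : \det P * (r * t) <= _); first by rewrite ler_pM2l.
apply: le_trans (_ : \det N * exp (- t) * (r * t) <= _).
  by rewrite ler_wpM2r // mulr_ge0 // ltW.
have -> : \det N * exp (- t) * (r * t) = r * (t * exp (- t)) * \det N by ring.
by rewrite ler_pM2r // ler_pM2l.
Qed.

(** * Mixed discriminants *)

(** In the double Leibniz sum, replacing [tau] by [s^-1 * tau] makes the choice of matrix depend on
    the row instead of the column. *)
Lemma mixed_discriminant_rows n (Q : 'I_n -> 'M[R]_n) :
  mixed_discriminant Q = \sum_(tau : 'S_n) \det (\matrix_(i, j) Q (tau i) i j).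
Proof.
rewrite /mixed_discriminant /determinant exchange_big [RHS]exchange_big /=.
apply: eq_bigr => s _; rewrite (reindex_inj (mulgI s^-1%g)) /=.
apply: eq_bigr => tau _; congr (_ * _); apply: eq_bigr => i _.
by rewrite !mxE permM permK.
Qed.

Lemma mixed_discriminant_tr n (Q : 'I_n -> 'M[R]_n) :
  mixed_discriminant (fun i => (Q i)^T) = mixed_discriminant Q.
Proof.
rewrite [RHS]mixed_discriminant_rows; apply: eq_bigr => tau _.
by rewrite -[RHS]det_tr; congr (\det _); apply/matrixP => i j; rewrite !mxE.
Qed.

Lemma mixed_discriminant_mull n (T : 'M[R]_n) (Q : 'I_n -> 'M[R]_n) :
  mixed_discriminant (fun i => T *m Q i) = \det T * mixed_discriminant Q.
Proof.
rewrite /mixed_discriminant mulr_sumr; apply: eq_bigr => tau _.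
rewrite -det_mulmx; congr (\det _); apply/matrixP => i j; rewrite !mxE.
by apply: eq_bigr => k _; rewrite !mxE.
Qed.

Lemma eq_mixed_discriminant n (Q Q' : 'I_n -> 'M[R]_n) :
  Q =1 Q' -> mixed_discriminant Q = mixed_discriminant Q'.
Proof.
move=> e; apply: eq_bigr => tau _; congr (\det _).
by apply/matrixP => i j; rewrite !mxE e.
Qed.

(** Left multiplication acts on each chosen column, so [T] factors out of every determinant; the
    right factor is moved to the left by transposition. *)
Lemma mixed_discriminant_congr n (T : 'M[R]_n) (Q : 'I_n -> 'M[R]_n) :
  mixed_discriminant (fun i => T *m Q i *m T^T) =
  \det T ^+ 2 * mixed_discriminant Q.
Proof.
have -> : mixed_discriminant (fun i => T *m Q i *m T^T) =
    mixed_discriminant (fun i => T *m (Q i *m T^T)).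
  by apply: eq_mixed_discriminant => i; rewrite mulmxA.
rewrite mixed_discriminant_mull expr2 -mulrA; congr (_ * _).
rewrite -(mixed_discriminant_tr Q) -mixed_discriminant_mull -[LHS]mixed_discriminant_tr.
by apply: eq_mixed_discriminant => i; rewrite trmx_mul trmxK.
Qed.

Lemma lift_perm_surj n (i j : 'I_n.+1) (s : 'S_n.+1) :
  s i = j -> exists t, lift_perm i j t = s.
Proof.
move=> sij; have ex k : exists k', s (lift i k) == lift j k'.
  have : j != s (lift i k) by rewrite -sij (inj_eq perm_inj) neq_lift.
  by case/unlift_some => k' -> _; exists k'.
pose f k := xchoose (ex k).
have fE k : lift j (f k) = s (lift i k) by apply/esym/eqP/(xchooseP (ex k)).
have f_inj : injective f.
  by move=> k l e; apply/(@lift_inj _ i)/(@perm_inj _ s); rewrite -!fE e.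
exists (perm f_inj); apply/permP => k.
case: (unliftP i k) => [l ->|->]; last by rewrite lift_perm_id.
by rewrite lift_perm_lift permE fE.
Qed.

Lemma lift_perm_inj n (i j : 'I_n.+1) : injective (@lift_perm n i j).
Proof.
move=> s t e; apply/permP => k; apply: (@lift_inj _ j).
by rewrite -!(lift_perm_lift i) e.
Qed.

Lemma sum_lift_perm n (i j : 'I_n.+1) (F : 'S_n.+1 -> R) :
  \sum_(s : 'S_n.+1 | s i == j) F s = \sum_(t : 'S_n) F (lift_perm i j t).
Proof.
transitivity (\sum_(s in [set lift_perm i j t | t : 'S_n]) F s).
  apply: eq_bigl => s; apply/eqP/imsetP => [/lift_perm_surj[t <-]|[t _ ->]].
    by exists t.
  exact: lift_perm_id.
by rewrite big_imset => [|s t _ _]; [apply: eq_bigl | apply: lift_perm_inj].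
Qed.

(** Group the permutations by the column [k] that they assign to the identity matrix. That column is
    the k-th unit vector, and expanding along it leaves the k-th principal minor with sign +1. *)
Lemma mixed_discriminant_id n (Q : 'I_n.+1 -> 'M[R]_n.+1) : Q ord0 = 1%:M ->
  mixed_discriminant Q =
  \sum_k mixed_discriminant (fun j => row' k (col' k (Q (lift ord0 j)))).
Proof.
move=> Q0; rewrite /mixed_discriminant.
rewrite (partition_big (fun s : 'S_n.+1 => (s^-1)%g ord0) predT) //=.
apply: eq_bigr => k _.
under eq_bigl => s do rewrite -(inj_eq (@perm_inj _ s)) permKV eq_sym.
rewrite sum_lift_perm; apply: eq_bigr => t _.
rewrite (expand_det_col _ k) (bigD1 k) //= big1 => [|i /negPf ik]; last first.
  by rewrite mxE lift_perm_id Q0 mxE ik mul0r.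
rewrite mxE lift_perm_id Q0 mxE eqxx addr0 mul1r /cofactor.
rewrite -signr_odd addnn odd_double mul1r; congr (\det _).
by apply/matrixP => i j; rewrite !mxE lift_perm_lift.
Qed.

Lemma sum_det_minors n (P : 'M[R]_n) : P \in unitmx ->
  \sum_k \det (row' k (col' k P)) = \det P * \tr (invmx P).
Proof.
move=> uP; rewrite /invmx uP mxtraceZ mulrA divff -?unitfE -?unitmxE // mul1r.
by apply: eq_bigr => k _; rewrite mxE /cofactor -signr_odd addnn odd_double mul1r.
Qed.

(** Written as a congruence by the identity with row [k] deleted, a minor inherits positivity and
    comparisons of quadratic forms. *)
Lemma minor_congr n k (A : 'M[R]_n.+1) :
  row' k (col' k A) = row' k 1%:M *m A *m (row' k 1%:M)^T.
Proof.
apply/matrixP => i j; rewrite !mxE (bigD1 (lift k j)) //= big1 => [|l /negPf lj].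
  rewrite !mxE eqxx mulr1 addr0 (bigD1 (lift k i)) //= big1 => [|l /negPf li].
    by rewrite !mxE eqxx mul1r addr0.
  by rewrite !mxE eq_sym li mul0r.
by rewrite !mxE eq_sym lj mulr0.
Qed.

Lemma pd_minor n k (A : 'M[R]_n.+1) : pd_mx A -> pd_mx (row' k (col' k A)).
Proof.
rewrite minor_congr; apply: (@pd_congr _ _ _ (row' k 1%:M)).
apply/matrixP => i j; rewrite !mxE (bigD1 (lift k i)) //= big1 => [|l /negPf li].
  by rewrite !mxE eqxx mul1r addr0 (inj_eq lift_inj) eq_sym.
by rewrite !mxE eq_sym li mul0r.
Qed.

Lemma mixed_discriminant_le n (alpha : R) (Q : 'I_n.+1 -> 'M[R]_n.+1) :
  1 <= alpha -> (forall i, pd_mx (Q i)) ->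
  (forall i j x, qform (Q i) x <= alpha * qform (Q j) x) ->
  mixed_discriminant Q <=
    exp (alpha * ln n.+1%:R - n%:R) * \det (\sum_i Q i).
Proof.
move=> a1; elim: n Q => [|n IH] Q pQ QQ.
  rewrite big_ord1 [X in ln X](_ : _ = 1) // ln_1 mulr0 subr0 exp_0 mul1r.
  rewrite /mixed_discriminant (big_pred1 1%g) => [|s]; last first.
    by apply/esym/eqP/permP => i; rewrite !ord1.
  by rewrite !det_mx11 !mxE perm1.
have [W [_ uW eW]] := cholesky (pQ ord0).
pose B i := invmx W *m Q i *m (invmx W)^T.
have uWt : W^T \in unitmx by rewrite unitmx_tr.
have eB i : Q i = W *m B i *m W^T.
  by rewrite /B !mulmxA mulmxV // mul1mx trmx_inv mulmxKV.
have pB i : pd_mx (B i) by apply: pd_congr_unit; rewrite ?unitmx_inv.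
have BB i j x : qform (B i) x <= alpha * qform (B j) x by rewrite !qform_congr.
have B0 : B ord0 = 1%:M.
  by rewrite /B eW trmx_inv mulmxA mulVmx // mul1mx mulmxV.
rewrite (eq_mixed_discriminant eB) mixed_discriminant_congr.
have -> : \sum_i Q i = W *m (\sum_i B i) *m W^T.
  by rewrite mulmx_sumr mulmx_suml; apply: eq_bigr.
rewrite !det_mulmx det_tr; set E := exp _; set S := \det (\sum_i B i).
have -> : E * (\det W * S * \det W) = \det W ^+ 2 * (E * S) by ring.
rewrite {}/E {}/S; apply: ler_wpM2l; first exact: sqr_ge0.
rewrite big_ord_recl B0 [1%:M + _]addrC mixed_discriminant_id //.
set P := \sum_(i < n.+1) _; set C := exp (alpha * ln n.+1%:R - n%:R) in IH.
have C0 : 0 < C by apply: exp_gt0.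
have pP : pd_mx P by apply: (pd_sum ord0).
(* Minors are additive, so the induction hypothesis bounds the k-th summand by [C] times the k-th
   principal minor of [P]; these minors sum to the trace of the adjugate. *)
apply: (@le_trans _ _ (C * (\det P * \tr (invmx P)))).
  rewrite -sum_det_minors ?pd_unit // mulr_sumr; apply: ler_sum => k _.
  apply: le_trans (IH _ _ _) _ => [j|i j x|].
  - exact: pd_minor.
  - by rewrite !minor_congr !qform_congr.
  by rewrite /P !raddf_sum.
have n0 : 0 < n.+1%:R :> R by rewrite ltr0n.
have k0 : 0 < n.+1%:R / alpha by rewrite divr_gt0 //; lra.
(* Each of the [n.+1] summands of [P] dominates [alpha^-1] times [B ord0], which is the identity. *)
have kP x : n.+1%:R / alpha * qform 1%:M x <= qform P x.
  rewrite mulrAC ler_pdivrMr; last lra.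
  rewrite /P qform_sum mulr_suml mulr_natl -[X in _ *+ X]card_ord -sumr_const.
  by apply: ler_sum => i _; rewrite mulrC -B0.
have := det_mxtrace_inv_le pP k0 kP; rewrite -(ler_pM2l C0) => /le_trans; apply.
rewrite mulrA; apply: ler_wpM2r; first by apply/ltW/pd_det_gt0/pdD => //; exact: pd1.
have ni : 0 <= n.+1%:R^-1 :> R by rewrite invr_ge0 ltW.
(* Here 1 + 1/k = 1 + alpha/(n+1), so Bernoulli applies with x = 1/(n+1). *)
have := bernoulli a1 ni; rewrite invf_div => h.
have -> : exp (alpha * ln n.+2%:R - n.+1%:R) =
    C * (exp (alpha * ln (1 + n.+1%:R^-1)) * exp (-1)).
  by rewrite /C -!expD ln_natr_succ -natr1; congr exp; ring.
by rewrite ler_pM2l // ler_pM2r ?exp_gt0.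
Qed.

(** * Extreme eigenvalues as Rayleigh bounds *)

(** A crude constant suffices: |x_i x_j| <= |x|^2 bounds each term, and the added 1 keeps [M]
    positive even when [A] is zero. *)
Lemma qform_le_norm n (A : 'M[R]_n) :
  exists2 M, 0 < M & forall x, qform A x <= M * qform 1%:M x.
Proof.
exists (\sum_i \sum_j `|A i j| + 1) => [|x].
  by apply: ltr_wpDl => //; apply: sumr_ge0 => i _; apply: sumr_ge0.
have le_q i : x i ord0 ^+ 2 <= qform 1%:M x.
  rewrite qform1 (bigD1 i) //= lerDl; apply: sumr_ge0 => j _; exact: sqr_ge0.
rewrite mulrDl mul1r ler_wpDr ?qform1_ge0 //.
rewrite exchange_big /= mulr_suml [qform A x]mxE; apply: ler_sum => j _.
rewrite mxE !mulr_suml; apply: ler_sum => i _; rewrite mxE.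
have h1 := le_q i; have h2 := le_q j.
apply: le_trans (ler_norm _) _; rewrite normrM normrM mulrAC mulrC.
apply: ler_wpM2l => //; rewrite -normrM ler_norml; apply/andP; split.
- have := sqr_ge0 (x i ord0 + x j ord0); rewrite sqrrD; lra.
have := sqr_ge0 (x i ord0 - x j ord0); rewrite sqrrB; lra.
Qed.

Lemma psd_unit_pd n (A : 'M[R]_n) : A^T = A -> A \in unitmx ->
  (forall x, 0 <= qform A x) -> pd_mx A.
Proof.
move=> sA uA A0; apply: pd_mxI => // x x0.
rewrite lt_def A0 andbT; apply/eqP => qx.
pose y := A *m x.
have y0 : y != 0.
  by apply: contra x0 => /eqP h; rewrite -[x](mulKmx uA) -/y h mulmx0.
have d0 := qform1_gt0 y0; set d := qform 1%:M y in d0.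
have c0 := A0 y; set c := qform A y in c0.
have c1 : 0 < c + 1 by lra.
(* If q(x) = 0 but y = A x is nonzero, then q(x - s y) < 0 for small s > 0. *)
pose s := d / (c + 1).
have es : s * (c + 1) = d by rewrite /s divfK ?gt_eqF.
have s0 : 0 < s by rewrite divr_gt0.
have h : qform A (x - s *: y) = qform A x - 2 * s * d + s ^+ 2 * c.
  have entryD (M N : 'M[R]_1) : (M + N) ord0 ord0 = M ord0 ord0 + N ord0 ord0.
    by rewrite !mxE.
  have entryZ (M : 'M[R]_1) r : (r *: M) ord0 ord0 = r * M ord0 ord0.
    by rewrite !mxE.
  have e1 : x^T *m A *m y = y^T *m y by rewrite /y trmx_mul sA.
  have e2 : y^T *m A *m x = y^T *m y by rewrite -mulmxA.
  have ed : d = (y^T *m y) ord0 ord0 by rewrite /d /qform mulmx1.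
  rewrite /qform -scaleNr [(x + _)^T]linearD /= [(_ *: _)^T]linearZ /=.
  rewrite !(mulmxDl, mulmxDr) -!(scalemxAl, scalemxAr) e1 e2 !(entryD, entryZ).
  by rewrite -ed -/(qform A x) -/(qform A y) -/c; ring.
(* Since [s * (c + 1) = d], [s * c < d], so the value is below [- s * d]; the added 1 covers
   [c = 0]. *)
have := A0 (x - s *: y); rewrite h qx; nra.
Qed.

(* The least a with a I - A psd is an eigenvalue: otherwise a I - A would be
   positive definite, hence at least eps I for some eps > 0. *)
Lemma max_eigenvalue n (A : 'M[R]_n.+1) : A^T = A ->
  exists2 a, eigenvalue A a & forall x, qform A x <= a * qform 1%:M x.
Proof.
move=> sA.
(* The sign is reversed so that the least admissible [a] becomes the supremum given by
   [completeness]. *)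
pose U m := forall x, qform A (x : 'cV[R]_n.+1) <= (- m) * qform 1%:M x.
pose e : 'cV[R]_n.+1 := delta_mx ord0 ord0.
have e0 : 0 < qform 1%:M e.
  by apply: qform1_gt0; apply/eqP => /matrixP /(_ ord0 ord0) /eqP;
    rewrite !mxE eqxx oner_eq0.
have U_ub : bound U.
  exists (- qform A e / qform 1%:M e) => m /(_ e) h; apply/RleP.
  by rewrite ler_pdivlMr //; lra.
have U_ex : exists m, U m.
  by have [M _ hM] := qform_le_norm A; exists (- M) => x; rewrite opprK.
have [b [b_ub b_lub]] := completeness U U_ub U_ex.
have Ub : U b.
  (* The supremum is attained: for each nonzero [x] the constraint is an upper bound on [m], hence
     also on [b]. *)
  move=> x; rewrite leNgt; apply/negP => h.
  have x0 : x != 0.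
    by apply/eqP => x0; move: h; rewrite x0 /qform !mulmx0 !mxE mulr0 ltxx.
  have q0 := qform1_gt0 x0.
  have : Rle b (- qform A x / qform 1%:M x).
    by apply: b_lub => m /(_ x) hm; apply/RleP; rewrite ler_pdivlMr //; lra.
  by move/RleP; rewrite ler_pdivlMr //; lra.
exists (- b); last exact: Ub.
pose B := (- b)%:M - A.
have sB : B^T = B by rewrite linearB /= tr_scalar_mx sA.
have qB x : qform B x = (- b) * qform 1%:M x - qform A x.
  by rewrite qformD qformN -[(- b)%:M]scalemx1 qformZ.
have nuB : B \notin unitmx.
  apply/negP => uB.
  have pB : pd_mx B by apply: psd_unit_pd => // x; rewrite qB subr_ge0.
  have [W [_ uW eW]] := cholesky pB.
  have uWt : W^T \in unitmx by rewrite unitmx_tr.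
  (* Bounding the form of the inverse Cholesky factor gives |x|^2 <= M B(x), so B >= I/M and
     [b + M^-1] would still lie in [U]. *)
  have [M M0 hM] := qform_le_norm ((invmx W^T)^T *m invmx W^T).
  have le_M x : qform 1%:M x <= M * qform B x.
    have := hM (W^T *m x).
    have := qform_congr (invmx W^T)^T 1%:M (W^T *m x).
    rewrite trmxK mulmx1 mulKmx // => ->.
    by have := qform_congr W 1%:M x; rewrite mulmx1 -eW => ->.
  have : U (b + M^-1).
    move=> x; have := le_M x; rewrite qB mulrC -ler_pdivrMr //; lra.
  move/b_ub/RleP; have : 0 < M^-1 by rewrite invr_gt0.
  lra.
have /det0P[v v0 vB] : \det B == 0.
  by move: nuB; rewrite unitmxE unitfE negbK.
apply/eigenvalueP; exists v => //.
by move/eqP: vB; rewrite mulmxBr mul_mx_scalar subr_eq0 => /eqP.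
Qed.

(** Chain [Q i] <= a I <= alpha b I <= alpha [Q j], with a the largest eigenvalue of [Q i] and b the
    smallest of [Q j]; the latter comes from [max_eigenvalue] applied to [- Q j]. *)
Lemma conditioned_qform_le n (alpha : R) (Q : 'I_n.+1 -> 'M[R]_n.+1) :
  1 <= alpha -> alpha_conditioned alpha Q ->
  forall i j x, qform (Q i) x <= alpha * qform (Q j) x.
Proof.
move=> a1 [pQ cQ] i j x.
have [a ea ha] := max_eigenvalue (pd_mx_tr (pQ i)).
have [b eb hb] : exists2 b, eigenvalue (Q j) b &
    forall x, b * qform 1%:M x <= qform (Q j) x.
  have [|b eb hb] := @max_eigenvalue _ (- Q j).
    by rewrite linearN /= (pd_mx_tr (pQ j)).
  exists (- b); last by move=> y; have := hb y; rewrite qformN; lra.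
  have /eigenvalueP[v vQ v0] := eb; apply/eigenvalueP; exists v => //.
  by move/eqP: vQ; rewrite mulmxN eqr_oppLR scaleNr => /eqP.
have /RleP hab := cQ i j a b ea eb.
apply: le_trans (ha x) _; apply: (@le_trans _ _ (alpha * b * qform 1%:M x)).
  by apply: ler_wpM2r => //; apply: qform1_ge0.
by rewrite -mulrA ler_wpM2l //; lra.
Qed.

(** * The bound for doubly stochastic tuples *)

Theorem theorem1p4 (n : nat) (alpha : R) (Q : 'I_n -> 'M[R]_n) :
  (1 <= n)%N ->
  Rle 1 alpha ->
  doubly_stochastic Q ->
  alpha_conditioned alpha Q ->
  Rle (mixed_discriminant Q)
      (Rmult (Rpower (INR n) (Rpow_def.pow alpha 4)) (exp (Ropp (Rminus (INR n) 1)))).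
Proof.
case: n Q => // n Q _ /RleP a1 [_ [sumQ _]] cQ; apply/RleP.
have INR_natr m : INR m = m%:R.
  by elim: m => // m IH; rewrite S_INR IH -natr1.
have := mixed_discriminant_le a1 (proj1 cQ) (conditioned_qform_le a1 cQ).
rewrite sumQ det1 mulr1 expD => /le_trans; apply.
rewrite INR_natr /Rpower.
have -> : Ropp (Rminus n.+1%:R 1) = - n%:R.
  by rewrite -natr1; congr (- _); apply: addrK.
apply: ler_wpM2r; first exact/ltW/exp_gt0.
have n1 : 1 <= n.+1%:R :> R by rewrite ler1n.
have ln0 : 0 <= ln n.+1%:R.
  move: n1; rewrite le_eqVlt => /orP[/eqP <-|/RltP h]; first by rewrite ln_1.
  by rewrite -[X in X <= _]ln_1; apply/ltW/RltP/ln_increasing => //; apply/RltP.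
have exp_mono (x y : R) : x <= y -> exp x <= exp y.
  by rewrite le_eqVlt => /orP[/eqP -> //|/RltP /exp_increasing /RltP /ltW].
(* The exponent obtained so far is [alpha], and [alpha <= alpha ^+ 4] because [alpha >= 1]. *)
apply: exp_mono; apply: ler_wpM2r => //.
have -> : Rpow_def.pow alpha 4 = alpha ^+ 4 by rewrite !exprS expr0.
by rewrite -[X in X <= _]expr1; apply: ler_weXn2l.
Qed.
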